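(* For every $n\ge0$, there is a bijection between the permutations of length $n$ in $\mathcal P$ and the words of length $3n$ in $\mathcal L$.
   Context: Token-passing system: tokens $1,\dots,n$ in an input queue in increasing order, a stack $A$ of capacity $2$ and a stack $B$ of unbounded capacity in series. Move $\rho$: next input token onto top of $A$; $\lambda$: top of $A$ onto top of $B$; $\mu$: top of $B$ to the output. A word $w\in\{\rho,\lambda,\mu\}^*$ generates the permutation $p$ if, starting from all tokens in input and empty stacks, all moves of $w$ are legal and at the end all tokens have been output in the order $p$. $\mathcal P$ is the set of all permutations generated by some word (i.e. generated by passing $12\dots n$ through a stack of depth 2 followed by an infinite stack in series). For a word $u$ and letters $a,b$, $D_{a,b}(u)$ = (number of $a$'s in $u$) minus (number of $b$'s in $u$). For $k\in\mathbb N$, $\mathcal L_{k,\infty}$ is the set of $w\in\{\rho,\lambda,\mu\}^*$ with $D_{\rho,\lambda}(u)\in[0,k]$ and $D_{\lambda,\mu}(u)\ge0$ for all prefixes $u$ of $w$, and $D_{\rho,\lambda}(w)=D_{\lambda,\mu}(w)=0$. The language $\mathcal L$ is the set of words $w\in\mathcal L_{2,\infty}$ that (i) do not contain the factor $\rho\mu$, (ii) do not have a prefix $w_0\rho\lambda w_1\lambda\mu$ with $w_1\in\mathcal L_{1,\infty}$ and $D_{\rho,\lambda}(w_0)=1$, and (iii) do not have a prefix $w_0\lambda\rho w_1\lambda\mu$ with $w_1\in\mathcal L_{1,\infty}$ and $D_{\rho,\lambda}(w_0)=1$. *)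

(* Defs.v *)
From HB Require Import structures.
From mathcomp Require Import all_boot all_order all_algebra all_fingroup.
From mathcomp Require Import boolp classical_sets functions.
Set Implicit Arguments.
Unset Strict Implicit.
Unset Printing Implicit Defensive.
Import Order.TTheory GRing.Theory Num.Theory.

Inductive move := Rho | Lam | Mu.

Definition nat_of_move (m : move) : nat :=
  match m with Rho => 0 | Lam => 1 | Mu => 2 end.

Definition move_of_nat (k : nat) : move :=
  match k with 0 => Rho | 1 => Lam | _ => Mu end.

Lemma nat_of_moveK : cancel nat_of_move move_of_nat.
Proof. by case. Qed.

HB.instance Definition _ := Countable.copy move (can_type nat_of_moveK).

(* The head of [input] is the next token, the heads of [stackA] and [stackB]
   are the tops of the stacks, and [output] is in order of exit. *)
Record state := State {
  input : seq nat;
  stackA : seq nat;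
  stackB : seq nat;
  output : seq nat
}.

(* [None] when the move is illegal; [k] is the capacity of stack A. *)
Definition step (k : nat) (m : move) (s : state) : option state :=
  match m, s with
  | Rho, State (x :: i) a b o =>
      if size a < k then Some (State i (x :: a) b o) else None
  | Lam, State i (x :: a) b o => Some (State i a (x :: b) o)
  | Mu, State i a (x :: b) o => Some (State i a b (rcons o x))
  | _, _ => None
  end.

Fixpoint run (k : nat) (w : seq move) (s : state) : option state :=
  if w is m :: w' then obind (run k w') (step k m s) else Some s.

Definition one_line (n : nat) (p : 'S_n) : seq nat :=
  [seq (val (p i)).+1 | i <- enum 'I_n].

Definition generates (k n : nat) (w : seq move) (p : 'S_n) : Prop :=
  run k w (State (iota 1 n) [::] [::] [::])
    = Some (State [::] [::] [::] (one_line p)).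

Definition calP (n : nat) : set 'S_n :=
  [set p | exists w : seq move, generates 2 w p]%classic.

Definition D (a b : move) (u : seq move) : int :=
  ((count_mem a u)%:Z - (count_mem b u)%:Z)%R.

Definition Lk (k : nat) : set (seq move) :=
  [set w | (forall u, prefix u w ->
              (0 <= D Rho Lam u <= k%:Z)%R /\ (0 <= D Lam Mu u)%R)
           /\ D Rho Lam w = 0%R /\ D Lam Mu w = 0%R]%classic.

Definition bad_prefix (a b : move) (w : seq move) : Prop :=
  exists w0 w1 : seq move,
    [/\ prefix (w0 ++ [:: a; b] ++ w1 ++ [:: Lam; Mu]) w,
        Lk 1 w1 & D Rho Lam w0 = 1%R].

Definition calL : set (seq move) :=
  [set w | [/\ Lk 2 w, ~~ infix [:: Rho; Mu] w,
               ~ bad_prefix Rho Lam w & ~ bad_prefix Lam Rho w]]%classic.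

(* Main.v *)
Require Import Defs.
From mathcomp Require Import all_boot all_order all_algebra all_fingroup.
From mathcomp Require Import boolp classical_sets functions.
From mathcomp Require Import zify.

(* Moving a [Mu] to the left, by [Rho; Mu] -> [Mu; Rho] or by
   [Rho; Lam] w1 [Lam; Mu] -> [Lam; Rho] w1 [Mu; Lam] (or the same with the
   first two letters exchanged), does not change the permutation, so a word
   whose [Mu]s are as early as possible lies in [calL].

   For uniqueness, look at the first letter where two words of [calL] with the
   same output differ. If one of the letters is [Mu], the order of the second
   stack forces a factor [Rho; Mu] in the other word. Otherwise one word
   continues with [Rho], the other with [Lam], with a single token a on the first
   stack and d next in the input. Whichever of a and d comes out first, in one of
   the words the other token waits at the bottom of the first stack until then,
   so that what is output up to that point avoids 312. In the other word the first
   stack can never be emptied just before a [Mu]: by induction such a [Mu]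
   would complete a forbidden prefix, unless a pattern 312 has occurred. So this
   word never terminates. *)

Set Implicit Arguments.
Unset Strict Implicit.
Unset Printing Implicit Defensive.

(** * Words read through the sizes of the two stacks *)

Definition counter_step (k : nat) (m : move) (q : nat * nat) : option (nat * nat) :=
  match m, q with
  | Rho, (a, b) => if a < k then Some (a.+1, b) else None
  | Lam, (a.+1, b) => Some (a, b.+1)
  | Mu, (a, b.+1) => Some (a, b)
  | _, _ => None
  end.

Fixpoint counter_run (k : nat) (w : seq move) (q : nat * nat) :=
  if w is m :: w' then obind (counter_run k w') (counter_step k m q) else Some q.

Lemma counter_run_cat k u v q :
  counter_run k (u ++ v) q = obind (counter_run k v) (counter_run k u q).
Proof. by elim: u q => //= m u IH q; case: counter_step => //=. Qed.

Lemma counter_run_shift k w j a b a' b' :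
  counter_run k w (a, b) = Some (a', b') ->
  counter_run k w (a, b + j) = Some (a', b' + j).
Proof.
elim: w a b => [|m w IH] a b /=; first by case=> -> ->.
case: m => /=; first by case: ltnP => //= _ /IH.
- by case: a => //= a /IH; rewrite addSn.
by case: b => //= b /IH.
Qed.

Lemma D_nil a b : D a b [::] = 0%R.
Proof. by []. Qed.

Lemma D_cat a b u v : D a b (u ++ v) = (D a b u + D a b v)%R.
Proof. rewrite /D !count_cat; lia. Qed.

Lemma D_cons a b m u :
  D a b (m :: u) = ((m == a)%:Z - (m == b)%:Z + D a b u)%R.
Proof. by rewrite -cat1s D_cat /D /= !addn0. Qed.

Lemma counter_runD k w a b a' b' : counter_run k w (a, b) = Some (a', b') ->
  (a%:Z + D Rho Lam w = a'%:Z)%R /\ (b%:Z + D Lam Mu w = b'%:Z)%R.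
Proof.
elim: w a b => [|m w IH] a b; rewrite ?D_nil ?D_cons /=; first by case=> -> ->; lia.
case: m => /=.
- by case: ltnP => //= _ /IH; lia.
- by case: a => //= a /IH; lia.
by case: b => //= b /IH; lia.
Qed.

Lemma counter_run_bounds k w a b a' b' : a <= k ->
  counter_run k w (a, b) = Some (a', b') -> a' <= k.
Proof.
elim: w a b => [|m w IH] a b ak /=; first by case=> <- _.
case: m => /=.
- by case: ltnP => //= lt /IH; apply.
- by case: a ak => //= a ak /IH; apply; apply: ltnW.
by case: b => //= b /IH; apply.
Qed.

(** The start [(a, b)] is arbitrary so that the induction can read off one letter at a time. *)
Lemma counter_run_prefixes k w a b : a <= k ->
  (forall u, prefix u w ->
     (0 <= a%:Z + D Rho Lam u <= k%:Z)%R /\ (0 <= b%:Z + D Lam Mu u)%R) ->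
  exists q, counter_run k w (a, b) = Some q.
Proof.
elim: w a b => [|m w IH] a b ak H /=; first by exists (a, b).
have {}H u : prefix u w ->
    (0 <= a%:Z + D Rho Lam (m :: u) <= k%:Z)%R /\ (0 <= b%:Z + D Lam Mu (m :: u))%R.
  by move=> uw; apply: H; rewrite prefix_cons eqxx.
have := H [::] (prefix0s _).
case: m H => H; rewrite !D_cons !D_nil /= => H1.
- have -> : a < k by lia.
  apply: IH; first by lia.
  by move=> u /H; rewrite !D_cons /=; lia.
- case: a ak H H1 => [|a] ak H H1; first by lia.
  apply: IH; first by lia.
  by move=> u /H; rewrite !D_cons /=; lia.
case: b H H1 => [|b] H H1; first by lia.
by apply: IH => // u /H; rewrite !D_cons /=; lia.
Qed.

(** The prefix inequalities say exactly that the pair of stack sizes stays legal. A run of sizes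
    composes along concatenation, which makes closure properties of [Lk] immediate. *)
Lemma LkP k w : Lk k w <-> counter_run k w (0, 0) = Some (0, 0).
Proof.
split=> [[H [H1 H2]]|H].
  have [|u /H|[a b] E] := @counter_run_prefixes k w 0 0; rewrite ?GRing.add0r //.
  have := counter_runD E; rewrite E H1 H2 => -[Ha Hb].
  by congr (Some (_, _)); lia.
have [H1 H2] := counter_runD H.
split; last by move: H1 H2; rewrite !GRing.add0r.
move=> u /prefixP [v E]; move: H; rewrite E counter_run_cat.
case E1: (counter_run k u (0, 0)) => [[a b]|] //= _.
have := counter_runD E1; have := counter_run_bounds (leq0n k) E1; lia.
Qed.

Lemma Lk_nil k : Lk k [::].
Proof. exact/LkP. Qed.

Lemma Lk_cat k u v : Lk k u -> Lk k v -> Lk k (u ++ v).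
Proof. by move=> /LkP Hu /LkP Hv; apply/LkP; rewrite counter_run_cat Hu. Qed.

(** The token pushed by [[:: Rho; Lam]] lies on the second stack under everything [w] does, and the
    final [Mu] removes it. *)
Lemma Lk_lift k w : Lk k.+1 w -> Lk k.+1 ([:: Rho; Lam] ++ w ++ [:: Mu]).
Proof.
move=> /LkP H; apply/LkP => /=.
by rewrite counter_run_cat -[1]add0n (counter_run_shift 1 H).
Qed.

(** * Runs of the token-passing system *)

Lemma run_cat k u v s : run k (u ++ v) s = obind (run k v) (run k u s).
Proof. by elim: u s => //= m u IH s; case: step => //=. Qed.

(** Tokens lying below never take part in the run; those under the first stack only use up capacity.
    So a word of [Lk 1] can run above one token of a first stack of capacity 2. *)
Lemma run_frame k w i a b o i' a' b' o' A B :
  run k w (State i a b o) = Some (State i' a' b' o') ->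
  run (k + size A) w (State i (a ++ A) (b ++ B) o)
    = Some (State i' (a' ++ A) (b' ++ B) o').
Proof.
elim: w i a b o => [|m w IH] i a b o /=; first by case=> -> -> -> ->.
case: m => /=.
- case: i => // x i; case: ltnP => //= lt /IH <-.
  by rewrite size_cat ltn_add2r lt.
- by case: a => //= x a /IH.
by case: b => //= x b /IH.
Qed.

Lemma run_counter k w s s' : run k w s = Some s' ->
  counter_run k w (size (stackA s), size (stackB s))
    = Some (size (stackA s'), size (stackB s'))
  /\ size (input s) = count_mem Rho w + size (input s').
Proof.
elim: w s => [|m w IH] [i a b o] /=; first by case=> <-.
case: m => /=.
- case: i => // x i; case: ltnP => //= lt /IH /= [-> ->]; split=> //; lia.
- by case: a => //= x a /IH /= [-> ->].
by case: b => //= x b /IH /= [-> ->].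
Qed.

Lemma counter_run_run k w s q :
  counter_run k w (size (stackA s), size (stackB s)) = Some q ->
  count_mem Rho w <= size (input s) -> exists s', run k w s = Some s'.
Proof.
elim: w s => [|m w IH] [i a b o] /=; first by exists (State i a b o).
case: m => /=.
- case: i => [|x i] /=; first by lia.
  case: ltnP => //= lt H c; exact: (IH (State i (x :: a) b o)) H c.
- case: a => //= x a H c; exact: (IH (State i a (x :: b) o)) H c.
case: b => //= x b H c; exact: (IH (State i a b (rcons o x))) H c.
Qed.

(** The multiset of all tokens is invariant under moves. When it has no repetition, [index y p]
    serves as the exit time of [y]. *)
Definition content (s : state) : seq nat :=
  input s ++ stackA s ++ stackB s ++ output s.

Lemma step_perm k m s s' : step k m s = Some s' -> perm_eq (content s) (content s').
Proof.
move=> E; apply/seq.permP => P; move: E.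
case: m; case: s => i a b o /=; rewrite /content.
- by case: i => // x i; case: ltnP => //= _ [<-] /=; rewrite !count_cat /= ?count_cat; lia.
- by case: a => //= x a [<-] /=; rewrite !count_cat /= ?count_cat; lia.
by case: b => //= x b [<-] /=; rewrite -cats1 !count_cat /= ?count_cat /=; lia.
Qed.

Lemma run_perm k w s s' : run k w s = Some s' -> perm_eq (content s) (content s').
Proof.
elim: w s => [|m w IH] s /=; first by case=> ->.
by case E: step => [t|] //= /IH; apply: perm_trans; apply: step_perm E.
Qed.

Lemma step_uniq k m s s' : step k m s = Some s' ->
  uniq (content s) -> uniq (content s').
Proof. by move=> /step_perm /perm_uniq ->. Qed.

Lemma run_output k w s s' : run k w s = Some s' ->
  exists t, output s' = output s ++ t.
Proof.
elim: w s => [|m w IH] s /=; first by case=> ->; exists [::]; rewrite cats0.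
case E: (step k m s) => [t|] //= /IH [l ->].
move: E; case: m; case: s => i a b o /=.
- by case: i => // x i; case: ltnP => //= _ [<-]; exists l.
- by case: a => //= x a [<-]; exists l.
by case: b => //= x b [<-]; exists (x :: l); rewrite cat_rcons.
Qed.

Lemma mem_content_output s y : uniq (content s) ->
  y \in input s ++ stackA s ++ stackB s -> y \notin output s.
Proof.
rewrite /content 2!catA cat_uniq -catA => /and3P [_ /hasPn no _] yi.
by apply/negP => /no /negP.
Qed.

(** * Order of exit of the tokens *)

Definition completes (k : nat) (w : seq move) (s : state) (p : seq nat) : Prop :=
  run k w s = Some (State [::] [::] [::] p).

Lemma index_pop k w i a h b o p y :
  completes k (Mu :: w) (State i a (h :: b) o) p ->
  uniq (content (State i a (h :: b) o)) -> y \in i ++ a ++ b ->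
  index h p < index y p.
Proof.
move=> R U yi; have Us : uniq (content (State i a b (rcons o h))).
  exact: (step_uniq (k := k) (m := Mu)) U.
have /= ho := mem_content_output (y := h) U; have /= yo := mem_content_output Us yi.
case: (run_output (R : run k w (State i a b (rcons o h)) = _)) => t /= ->.
rewrite !index_cat (negPf yo) mem_rcons mem_head -cats1 index_cat (negPf (ho _)).
  by rewrite /= eqxx addn0 size_cat /= addn1 addSn ltnS leq_addr.
by rewrite !mem_cat mem_head !orbT.
Qed.

Lemma index_pop_leq k w i a h b o p y :
  completes k (Mu :: w) (State i a (h :: b) o) p ->
  uniq (content (State i a (h :: b) o)) -> y \in i ++ a ++ h :: b ->
  index h p <= index y p.
Proof.
move=> R U; case: (eqVneq y h) => [-> //|yh yi].
by apply: ltnW; apply: index_pop R U _; move: yi; rewrite !mem_cat inE (negPf yh).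
Qed.

Lemma stack_order k w i a b1 x b2 o p c :
  completes k w (State i a (b1 ++ x :: b2) o) p ->
  uniq (content (State i a (b1 ++ x :: b2) o)) -> c \in b2 ->
  index x p < index c p.
Proof.
move=> R U cb; elim: w i a b1 o R U => [|m w IH] i a b1 o; first by case: b1.
case: m => /=.
- case: i => // y i R U; move: R; rewrite /completes /=; case: ltnP => //= lt R.
  by apply: IH R _; apply: (step_uniq (k := k) (m := Rho)) U; rewrite /= lt.
- case: a => //= y a R U; apply: (IH _ _ (y :: b1)) R _.
  exact: (step_uniq (k := k) (m := Lam)) U.
case: b1 => [|y b1] R U.
  by apply: index_pop R U _; rewrite !mem_cat cb !orbT.
by apply: (IH _ _ b1 _ R); apply: (step_uniq (k := k) (m := Mu)) U.
Qed.

(* While [y0] sits at the bottom of the first stack, the tokens entering after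
   it go through a single infinite stack, which cannot produce the pattern 312. *)
Lemma single_stack_avoids_312 w i a y0 b x0 bs o p z c x :
  size a <= 1 ->
  completes 2 w (State i (rcons a y0) (b ++ x0 :: bs) o) p ->
  uniq (content (State i (rcons a y0) (b ++ x0 :: bs) o)) ->
  pairwise gtn (rev i ++ a ++ rcons b x0) ->
  index x0 p < index y0 p ->
  z \in rev i ++ a ++ rcons b x0 -> c \in rev i ++ a ++ rcons b x0 ->
  x \in rev i ++ a ++ rcons b x0 ->
  c < x < z -> index z p < index c p -> index c p < index x p ->
  index c p <= index x0 p -> False.
Proof.
move=> sa R U dec xy zin cin xin /andP[cx xz] zc cxp cx0.
elim: w i a b o sa R U dec zin cin xin => [|m w IH] i a b o sa.
  by case: b.
case: m => /=.
- case: i => // d i R U; move: R; rewrite /completes /=; case: ltnP => //=.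
  (* With [y0] at the bottom of a stack of capacity 2, a push requires [a] to be empty; the
     decreasing list then stays the same as a whole. *)
  rewrite size_rcons !ltnS leqn0 => /nilP a0 R; subst a.
  rewrite rev_cons cat_rcons => dec zin cin xin.
  by apply: (IH i [:: d] b o) => //; apply: (step_uniq (k := 2) (m := Rho)) U.
- case: a sa => [|h a] sa R U.
    (* Moving [y0] would place it above [x0], so it would exit before [x0]. *)
    suff yx : index y0 p < index x0 p by have := ltn_trans xy yx; rewrite ltnn.
    apply: (@stack_order 2 w i [::] [::] y0 (b ++ x0 :: bs) o); first exact: R.
      exact: (step_uniq (k := 2) (m := Lam)) U.
    by rewrite mem_cat mem_head orbT.
  case: a sa R U => // _ R U dec zin cin xin.
  by apply: (IH i [::] (h :: b) o) => //; apply: (step_uniq (k := 2) (m := Lam)) U.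
case: b => [|h b] R U.
  (* Here [x0] is popped while [z] is still inside, yet [z] has to exit before [c], and [c] no later
     than [x0]. *)
  move=> _ zin _ _; suff : index x0 p <= index z p by lia.
  apply: index_pop_leq R U _; move: zin.
  by rewrite !mem_cat mem_rev !mem_rcons !inE ?orbF => /or3P[] ->; rewrite ?orbT.
rewrite rcons_cons => dec.
have mem y : y \in rev i ++ a ++ h :: rcons b x0 -> y != h ->
    y \in rev i ++ a ++ rcons b x0 /\ index h p < index y p.
  rewrite !mem_cat !inE => + /negPf yh; rewrite yh /= => yin; split=> //.
  apply: index_pop R U _; move: yin.
  rewrite !mem_cat mem_rev !mem_rcons !inE.
  by case/or4P => ->; rewrite ?orbT.
move=> zin cin xin.
have [zh|zh] := eqVneq z h; last first.
  have [|zin' hz] := mem z zin; first exact: zh.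
  have [ch|ch] := eqVneq c h; first by move: zc hz; rewrite ch; lia.
  have [cin' hc] := mem c cin ch.
  have [xh|xh] := eqVneq x h; first by move: cxp hc; rewrite xh; lia.
  have [xin' _] := mem x xin xh.
  apply: (IH i a b (rcons o h)) => //.
    exact: (step_uniq (k := 2) (m := Mu)) U.
  apply: subseq_pairwise dec.
  by rewrite !cat_subseq // subseq_cons.
(* The critical moment is the pop of [z]. The smaller tokens of the decreasing list already lie
   below [z] on the second stack, [x] above [c], so [x] exits before [c]. *)
have low y : y \in rev i ++ a ++ h :: rcons b x0 -> y < h -> y \in rcons b x0.
  move=> + yh; rewrite catA mem_cat inE => /or3P[yl|/eqP yh'|//].
    move: dec; rewrite catA pairwise_cat allrel_consr => /and3P[/andP[/allP /(_ _ yl)]].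
    by rewrite /=; lia.
  by move: yh; rewrite yh' ltnn.
subst z; have := low _ cin (ltn_trans cx xz).
move: dec R U; rewrite cat_cons -(cat_rcons x0).
case/path.splitPr: (rcons b x0) / (low _ xin xz) => s1 s2 dec R U.
rewrite mem_cat inE => /or3P[cs|/eqP cx'|cs].
- suff : pairwise gtn ([:: c] ++ [:: x]) by rewrite /= !andbT => /(ltn_trans cx); rewrite ltnn.
  apply: subseq_pairwise dec; rewrite -cat_cons !catA cat_subseq //.
    by rewrite sub1seq !(mem_cat, inE) cs !orbT.
  by rewrite sub1seq mem_head.
- by move: cx; rewrite cx' ltnn.
suff : index x p < index c p by lia.
apply: (@stack_order 2 w i (rcons a y0) s1 x (s2 ++ bs) (rcons o h)).
- by move: R; rewrite -catA.
- rewrite -cat_cons catA; exact: (step_uniq (k := 2) (m := Mu)) U.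
by rewrite mem_cat cs.
Qed.

(** * Forbidden factorizations carried along a word *)

(* [frames ws ts p x0 w x b]: after reading [w], which extends [ws], the token
   [x] is alone on the first stack and the tokens [b] have been pushed on the
   second one since [ws] was read. Each pushed token comes with a factorization
   of [w] that forbids the continuation [Lam; Mu]. *)
Fixpoint frames (ws : seq move) (ts p : seq nat) (x0 : nat)
    (w : seq move) (x : nat) (b : seq nat) : Prop :=
  if b is c :: b' then
    exists w' w1, [/\ Lk 1 w1, D Rho Lam w' = 1%R &
      [/\ w = w' ++ [:: Rho; Lam] ++ w1, x < c & frames ws ts p x0 w' x b']
      \/ [/\ w = w' ++ [:: Lam; Rho] ++ w1, c < x, frames ws ts p x0 w' c b'
           & w1 = [::] \/ exists z, [/\ z \in ts, x < z & index z p < index c p]]]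
  else x = x0 /\ exists2 w1, Lk 1 w1 & w = ws ++ w1.

(** Only the last factor [w1] grows. In the [[:: Lam; Rho]] case it may stop being empty, and [z]
    then takes over as the witness of the final alternative. *)
Lemma frames_append ws ts p x0 w x b v z :
  frames ws ts p x0 w x b -> Lk 1 v -> z \in ts -> x < z ->
  {in b, forall c, index z p < index c p} ->
  frames ws ts p x0 (w ++ v) x b.
Proof.
case: b => [|c b] /=.
  move=> [-> [w1 Hw1 ->]] Hv _ _ _; split=> //.
  by exists (w1 ++ v); [apply: Lk_cat | rewrite catA].
move=> [w' [w1 [Hw1 Dw H]]] Hv zt xz zb.
exists w', (w1 ++ v); split=> //; first exact: Lk_cat.
case: H => -[-> lt F].
  by left; split=> //; rewrite -!catA.
move=> _; right; split=> //; first by rewrite -!catA.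
by right; exists z; split=> //; apply: zb; rewrite mem_head.
Qed.

(** The shape of either word just after the divergence; it provides the forbidden factorization
    while [b] is empty. *)
Definition swap_start (w : seq move) : Prop :=
  exists w0, D Rho Lam w0 = 1%R /\
    (w = w0 ++ [:: Rho; Lam] \/ w = w0 ++ [:: Lam; Rho]).

Lemma frames_no_pop ws ts p x0 w x b r :
  frames ws ts p x0 w x b -> swap_start ws -> ~ calL (w ++ Lam :: Mu :: r).
Proof.
move=> F S.
have [w0 [w1 [Hw1 Dw0 E]]] : exists w0 w1, [/\ Lk 1 w1, D Rho Lam w0 = 1%R &
   w = w0 ++ [:: Rho; Lam] ++ w1 \/ w = w0 ++ [:: Lam; Rho] ++ w1].
  case: b F => [|c b] /=.
    move=> [_ [w1 Hw1 ->]]; case: S => w0 [Dw0 E].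
    exists w0, w1; split=> //.
    by case: E => ->; [left|right]; rewrite -catA.
  move=> [w' [w1 [Hw1 Dw H]]]; exists w', w1; split=> //.
  by case: H => -[-> _ _]; [left|right].
case=> _ _ N1 N2; case: E => E; [apply: N1|apply: N2]; exists w0, w1; split=> //;
  by rewrite E -!catA !cat_cons; apply/prefixP; exists r; rewrite -!catA /= -!catA.
Qed.

(** Induction on the length of [r]. With [x] alone on the first stack, the only possible
    continuations are [[:: Rho; Lam]], [[:: Lam; Rho]] and [Mu]: the capacity, the factor
    [[:: Rho; Mu]] and [frames_no_pop] exclude the others. Each of the three either preserves the
    invariant or is contradictory, so the first stack is never left empty. The token [x0] stays
    inside because [b0] exits after it. *)
Lemma frames_stuck ws ts p x0 b0 bs r w x b i o :
  calL (w ++ r) -> swap_start ws -> frames ws ts p x0 w x b ->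
  D Rho Lam w = 1%R ->
  completes 2 r (State i [:: x] (b ++ b0 :: bs) o) p ->
  uniq (content (State i [:: x] (b ++ b0 :: bs) o)) ->
  pairwise ltn (x :: i) -> {subset x :: b ++ i <= ts} ->
  x0 \in x :: b -> index x0 p < index b0 p ->
  {in ts, forall y, x0 <= y} ->
  (forall z c y, z \in ts -> c \in ts -> y \in ts -> c < y < z ->
     index z p < index c p -> index c p < index y p ->
     index c p <= index x0 p -> False) ->
  False.
Proof.
move=> Hw S F Dw R U srt sub xin lt x0min avoid.
have [m] := ubnP (size r).
elim: m r w x b i o Hw F Dw R U srt sub xin => // m IH [//|[] r].
all: move=> w x b i o Hw F Dw R U srt sub xin.
- case: i R U srt sub => // d i R U srt sub sm.
  case: r R Hw sm => [//|[] r] R Hw sm.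
  + by case: i {U srt sub} R => [|? ?]; rewrite /completes.
  + apply: (IH r (w ++ [:: Rho; Lam]) x (d :: b) i o); rewrite -?catA //.
    * exists w, [::]; split=> //; first exact: Lk_nil.
      by left; split=> //; move: srt => /= /andP[/andP[]].
    * by rewrite D_cat Dw.
    * apply: (step_uniq (k := 2) (m := Lam) (s := State i [:: d; x] (b ++ b0 :: bs) o)) => //.
      exact: (step_uniq (k := 2) (m := Rho)) U.
    * by move: srt => /= /andP[/andP[_ ->] /andP[_ ->]].
    * by move=> y yin; apply: sub; move: yin;
        rewrite !(inE, mem_cat) => /or4P[] ->; rewrite ?orbT.
    * by move: xin; rewrite !inE => /orP[] ->; rewrite ?orbT.
    * by move: sm => /=; lia.
  case: Hw => _ /negP N _ _; case: N; apply/infixP; by exists w, r.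
- case: r R Hw => [//|[] r] R Hw sm.
  + case: i R U srt sub => // d i R U srt sub.
    apply: (IH r (w ++ [:: Lam; Rho]) d (x :: b) i o); rewrite -?catA //.
    * exists w, [::]; split=> //; first exact: Lk_nil.
      by right; split=> //; [move: srt => /= /andP[/andP[]] | left].
    * by rewrite D_cat Dw.
    * apply: (step_uniq (k := 2) (m := Rho) (s := State (d :: i) [::] (x :: b ++ b0 :: bs) o)) => //.
    * by move: srt => /= /andP[_ ->].
    * by move=> y yin; apply: sub; move: yin;
        rewrite !(inE, mem_cat) => /or4P[] ->; rewrite ?orbT.
    * by rewrite inE xin orbT.
    * by move: sm => /=; lia.
  + by move: R; rewrite /completes.
  by case: (frames_no_pop F S Hw).
move=> sm; case: b F R U sub xin => [|c b] F R U sub xin.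
  (* Nothing lies above [b0], so this [Mu] pops it before [x0]. *)
  case: F => xx0 _; have := index_pop R U (y := x0).
  by rewrite xx0 mem_cat mem_head orbT => /(_ isT); rewrite ltnNge (ltnW lt).
case: F => w' [w1 [Hw1 Dw' [[Ew xc F]|[Ew cx F Z]]]].
(* The popped [c] was pushed by [[:: Rho; Lam]]: its whole block, closed by this [Mu], lies in
   [Lk 1] and is absorbed into the frame below, with the larger token [c] as witness. *)
- have Ew' : (w ++ [:: Mu]) = w' ++ ([:: Rho; Lam] ++ w1 ++ [:: Mu]).
    by rewrite Ew -!catA.
  have x0c : x0 != c.
    have := x0min x (sub x (mem_head _ _)); rewrite neq_ltn; lia.
  apply: (IH r (w ++ [:: Mu]) x b i (rcons o c)); rewrite -?catA //.
  + rewrite Ew'; apply: (frames_append (z := c)) F _ _ xc _.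
    * exact: Lk_lift.
    * by apply: sub; rewrite !inE eqxx orbT.
    * by move=> y yb; apply: index_pop R U _; rewrite !mem_cat yb !orbT.
  + by rewrite D_cat Dw.
  + exact: (step_uniq (k := 2) (m := Mu)) U.
  + by move=> y yin; apply: sub; move: yin;
        rewrite !(inE, mem_cat) => /or3P[] ->; rewrite ?orbT.
  by move: xin; rewrite !inE (negPf x0c).
(* The popped [c] was pushed by [[:: Lam; Rho]]. If nothing followed, this [Mu] creates the factor
   [[:: Rho; Mu]]; otherwise [z], [c], [x] form a pattern 312 with [c] out no later than [x0]. *)
case: Z => [w10|[z [zt xz zc]]].
  move: Hw; rewrite Ew w10 => -[_ /negP N _ _]; case: N; apply/infixP.
  by exists (w' ++ [:: Lam]), r; rewrite -!catA.
apply: (avoid z c x) => //.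
- by apply: sub; rewrite !inE eqxx orbT.
- by apply: sub; rewrite mem_head.
- by rewrite cx.
- by apply: index_pop R U _; rewrite mem_cat mem_head orbT.
apply: index_pop_leq R U _; move: xin; rewrite !(mem_cat, inE).
by case/or3P => xx0; rewrite xx0 ?orbT.
Qed.

(** * Uniqueness of the word in [calL] *)

Lemma run_increasing k w s s' : run k w s = Some s' ->
  pairwise ltn (rev (stackA s) ++ input s) ->
  pairwise ltn (rev (stackA s') ++ input s').
Proof.
elim: w s => [|m w IH] s /=; first by case=> ->.
case E: step => [t|] //= /IH H dec; apply: H; move: E dec.
case: m; case: s => i a b o /=.
- by case: i => // d i; case: ltnP => //= _ [<-] /=; rewrite rev_cons cat_rcons.
- case: a => // d a [<-] /=; apply: subseq_pairwise.
  by rewrite rev_cons cat_rcons cat_subseq // subseq_cons.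
by case: b => // d b [<-].
Qed.

(** A [Lam] before the pop of [t] would bury [t] under a token that must exit later. So only [Rho]
    could precede that pop, and the last of them would form [[:: Rho; Mu]]. *)
Lemma next_pop k r i a t b o p :
  completes k r (State i a (t :: b) o) p ->
  uniq (content (State i a (t :: b) o)) -> ~~ infix [:: Rho; Mu] r ->
  {in i ++ a, forall y, index t p <= index y p} ->
  exists r', r = Mu :: r'.
Proof.
elim: r i a => [|[] r IH] i a R U N first_t; first by [].
- case: i R U first_t => // d i R U first_t.
  have [r' E] : exists r', r = Mu :: r'.
    apply: (IH i (d :: a)).
    + by move: R; rewrite /completes /=; case: ltnP.
    (* Uniqueness of the tokens does not depend on the capacity, so any capacity that admits the
       push serves. *)
    + apply: (step_uniq (k := (size a).+1) (m := Rho)) U.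
      by rewrite /= ltnSn.
    + by move: N; rewrite infix_consl negb_or => /andP[].
    + move=> y; rewrite mem_cat inE orbCA -mem_cat => yin.
      by apply: first_t; rewrite cat_cons inE.
  by move: N; rewrite E infix_consl !prefix_cons prefix0s.
- case: a R U first_t => // y a R U first_t.
  have := @stack_order k r i a [::] y (t :: b) o p t R _ (mem_head _ _).
  have := first_t y; rewrite mem_cat mem_head orbT => /(_ isT) le lt.
  suff : index y p < index t p by rewrite ltnNge le.
  by apply: lt; apply: (step_uniq (k := k) (m := Lam)) U.
by exists r.
Qed.

Lemma calL_no_rho_mu w r : calL (w ++ r) -> ~~ infix [:: Rho; Mu] r.
Proof. by case=> _ N _ _; apply: contra N; apply: infix_catl. Qed.

Lemma rho_lam_diverge w r1 r2 d i a b o p :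
  calL (w ++ Rho :: r1) -> calL (w ++ Lam :: r2) -> D Rho Lam w = 1%R ->
  completes 2 (Rho :: r1) (State (d :: i) [:: a] b o) p ->
  completes 2 (Lam :: r2) (State (d :: i) [:: a] b o) p ->
  uniq (content (State (d :: i) [:: a] b o)) ->
  pairwise ltn [:: a, d & i] -> False.
Proof.
move=> L1 L2 Dw R1 R2 U inc.
have U1 : uniq (content (State i [:: d; a] b o)).
  exact: (step_uniq (k := 2) (m := Rho)) U.
have U2 : uniq (content (State (d :: i) [::] (a :: b) o)).
  exact: (step_uniq (k := 2) (m := Lam)) U.
have U2' : uniq (content (State i [:: d] (a :: b) o)).
  exact: (step_uniq (k := 2) (m := Rho)) U2.
have inc_a : pairwise ltn (a :: i) by move: inc => /= /andP[/andP[_ ->] /andP[_ ->]].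
have inc_d : pairwise ltn (d :: i) by move: inc => /= /andP[_ ->].
have minP y0 : pairwise ltn (y0 :: i) -> {in y0 :: i, forall y, y0 <= y}.
  by move=> /= /andP[/allP al _] y; rewrite inE => /predU1P[->//|/al /ltnW].
have decP y0 : pairwise ltn (y0 :: i) -> pairwise gtn (rev i ++ [:: y0]).
  move=> inc_y0; have : sorted ltn (y0 :: i) by rewrite pairwise_sorted.
  rewrite cats1 -rev_cons -sorted_pairwise ?rev_sorted //.
  by move=> y x z xy yz; apply: ltn_trans yz xy.
have memP y0 : y0 :: i =i rev i ++ [:: y0].
  by move=> y; rewrite mem_cat mem_rev !inE orbC.
case: r1 L1 R1 => [//|[] r1] L1 R1.
- by case: i {U U1 U2 U2' inc inc_a inc_d minP decP memP R2} R1.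
- have U1' : uniq (content (State i [:: a] (d :: b) o)).
    exact: (step_uniq (k := 2) (m := Lam)) U1.
  (* The words now have [a] on the first stack and [d] on top of the second, or the reverse. The
     stuck word is the one whose second stack holds the token that exits later. *)
  have [ad|da|E] := ltngtP (index a p) (index d p).
  + apply: (@frames_stuck (w ++ [:: Rho; Lam]) (a :: i) p a d b r1
        (w ++ [:: Rho; Lam]) a [::] i o) => //.
    * by rewrite -catA.
    * by exists w; split=> //; left.
    * by split=> //; exists [::]; [apply: Lk_nil | rewrite cats0].
    * by rewrite D_cat Dw.
    * by rewrite mem_head.
    * exact: minP.
    (* Avoidance is read off the other word, where [d] waits on the first stack until [a] is out; if
       [a] is popped at once, no [z] precedes it. *)
    move=> z c y; rewrite !memP => zin cin yin cyz zc cy ca.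
    case: r2 L2 R2 => [//|[] r2] L2 R2.
    * apply: (@single_stack_avoids_312 r2 i [::] d [::] a b o p z c y) => //.
      exact: decP.
    * by move: R2; rewrite /completes.
    suff : index a p <= index z p by lia.
    apply: index_pop_leq R2 U2 _.
    by move: zin; rewrite -memP !(inE, mem_cat) => /orP[] ->; rewrite ?orbT.
  + case: r2 L2 R2 => [//|[] r2] L2 R2.
    * apply: (@frames_stuck (w ++ [:: Lam; Rho]) (d :: i) p d a b r2
        (w ++ [:: Lam; Rho]) d [::] i o) => //.
      - by rewrite -catA.
      - by exists w; split=> //; right.
      - by split=> //; exists [::]; [apply: Lk_nil | rewrite cats0].
      - by rewrite D_cat Dw.
      - by rewrite mem_head.
      - exact: minP.
      move=> z c y; rewrite !memP => zin cin yin cyz zc cy ca.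
      apply: (@single_stack_avoids_312 r1 i [::] a [::] d b o p z c y) => //.
      exact: decP.
    * by move: R2; rewrite /completes.
    have := index_pop R2 U2 (y := d); rewrite mem_head => /(_ isT).
    by rewrite ltnNge (ltnW da).
  have := run_perm R2; rewrite /content /= => /perm_mem pm.
  have ap : a \in p by rewrite -pm !(inE, mem_cat) eqxx ?orbT.
  have dp : d \in p by rewrite -pm !(inE, mem_cat) eqxx ?orbT.
  have ad : a = d by rewrite -(nth_index 0 ap) E nth_index.
  by move: inc; rewrite /= ad ltnn.
by have := calL_no_rho_mu L1; rewrite infix_consl !prefix_cons prefix0s.
Qed.

Definition start n := State (iota 1 n) [::] [::] [::].

Lemma start_uniq n w s : run 2 w (start n) = Some s -> uniq (content s).
Proof. by move=> /run_perm /perm_uniq <-; rewrite /content /= cats0 iota_uniq. Qed.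

(** Induction along the common prefix [w], which is kept because membership in [calL] concerns the
    whole word. *)
Lemma calL_completes_inj n r1 r2 w s p :
  calL (w ++ r1) -> calL (w ++ r2) -> run 2 w (start n) = Some s ->
  completes 2 r1 s p -> completes 2 r2 s p -> r1 = r2.
Proof.
elim: r1 r2 w s => [|m1 r1 IH] [|m2 r2] w s L1 L2 W R1 R2.
- by [].
- by move: R1 R2; rewrite /completes /= => -[->]; case: m2 {L2}.
- by move: R1 R2; rewrite /completes /= => + [E]; rewrite E; case: m1 {L1}.
have U := start_uniq W.
have [E|neq] := eqVneq m1 m2.
  subst m2; congr (_ :: _); case E : (step 2 m1 s) => [s'|]; last first.
    by move: R1; rewrite /completes /= E.
  apply: (IH _ (rcons w m1) s'); rewrite ?cat_rcons //.
  - by rewrite -cats1 run_cat W /= E.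
  - by move: R1; rewrite /completes /= E.
  by move: R2; rewrite /completes /= E.
have mu_first m r r' : m != Mu -> calL (w ++ m :: r) ->
    completes 2 (m :: r) s p -> completes 2 (Mu :: r') s p -> False.
  case: s W U {R1 R2} => i a [//|t b] o W U mM L R R'.
  have [|r'' E] := next_pop R U (calL_no_rho_mu L); last by case: E mM => ->.
  move=> y yin; apply: index_pop_leq R' U _.
  by rewrite catA mem_cat yin.
have rho_lam r r' : calL (w ++ Rho :: r) -> calL (w ++ Lam :: r') ->
    completes 2 (Rho :: r) s p -> completes 2 (Lam :: r') s p -> False.
  move=> L L' R R'.
  have inc : pairwise ltn (rev (stackA s) ++ input s).
    apply: run_increasing W _; rewrite /= -sorted_pairwise ?iota_ltn_sorted //.
    exact: ltn_trans.
  have [/= Dw _] := counter_runD (run_counter W).1.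
  (* [Rho] and [Lam] are both legal only with a token left in the input and exactly one on the first
     stack. *)
  case: s W U inc Dw R R' {R1 R2 mu_first} => [[|d i] [|a [|? ?]] b o] //= W U inc Dw R R'.
  by apply: (rho_lam_diverge L L' _ R R' U inc); lia.
by case: m1 m2 neq L1 L2 R1 R2 => [] [] // _ L1 L2 R1 R2; exfalso;
  first [ exact: rho_lam L1 L2 R1 R2 | exact: rho_lam L2 L1 R2 R1
        | exact: (mu_first _ _ _ _ L1 R1 R2) | exact: (mu_first _ _ _ _ L2 R2 R1) ].
Qed.

(** * Existence of a word in [calL] by rewriting *)

Lemma Lk1_run i o w : Lk 1 w -> count_mem Rho w <= size i ->
  exists i' o', forall x b,
    run 2 w (State i [:: x] b o) = Some (State i' [:: x] b o').
Proof.
move=> /LkP C c; have [[i' a' b' o'] R] := @counter_run_run 1 w (State i [::] [::] o) _ C c.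
have [/= E _] := run_counter R; move: E; rewrite C => -[ea eb].
case: a' ea R => // _; case: b' eb => // _ R.
by exists i', o' => x b; apply: (run_frame [:: x] b R).
Qed.

(** The two starts leave [a] and the next token [d] in exchanged places. The block [w] runs above
    both in the same way, and afterwards [[:: Lam; Mu]] and [[:: Mu; Lam]] output the same token and
    leave the other on the second stack. *)
Lemma Lk1_block_run u v r w i a b o s :
  Lk 1 w ->
  (u, v) = ([:: Rho; Lam], [:: Lam; Rho]) \/ (u, v) = ([:: Lam; Rho], [:: Rho; Lam]) ->
  run 2 (u ++ w ++ [:: Lam; Mu] ++ r) (State i [:: a] b o) = Some s ->
  run 2 (v ++ w ++ [:: Mu; Lam] ++ r) (State i [:: a] b o) = Some s.
Proof.
move=> L uv; case: i => [|d i]; first by case: uv => -[-> ->].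
have [c|c] := leqP (count_mem Rho w) (size i).
  have [i' [o' E]] := Lk1_run o L c.
  by case: uv => -[-> ->] /=; rewrite !run_cat !E.
have short t z : run 2 w (State i [:: z] t o) = None.
  case R: run => [t'|] //; have [_ E] := run_counter R.
  by move: c; rewrite [size i]E ltnNge leq_addr.
by case: uv => -[-> ->] /=; rewrite run_cat short.
Qed.

Lemma rho_mu_run k r s s' :
  run k (Rho :: Mu :: r) s = Some s' -> run k (Mu :: Rho :: r) s = Some s'.
Proof.
case: s => [[|d i] a b o] //=; case: ltnP => //= lt.
by case: b => //= t b; rewrite lt.
Qed.

(* For [c = 0], the number of pairs of a [Mu] and an earlier letter other than [Mu]. *)
Fixpoint mu_delay (c : nat) (w : seq move) : nat :=
  match w with
  | [::] => 0
  | Mu :: w' => c + mu_delay c w'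
  | _ :: w' => mu_delay c.+1 w'
  end.

Lemma mu_delay_cat c u v :
  mu_delay c (u ++ v) = mu_delay c u + mu_delay (c + count (predC1 Mu) u) v.
Proof.
elim: u c => [|m u IH] c /=; first by rewrite addn0.
by case: m => /=; rewrite IH ?add1n ?add0n ?addnS ?addSn ?addnA.
Qed.

(** Each rewriting moves one [Mu] ahead of one other letter and lowers [mu_delay 0] by 1; a
    generating word that admits none lies in [calL]. *)
Lemma generated_by_calL n w p : completes 2 w (start n) p ->
  exists2 w', calL w' & completes 2 w' (start n) p.
Proof.
have [m] := ubnP (mu_delay 0 w); elim: m w => // m IH w; rewrite ltnS => wm R.
have [/infixP [u [v E]]|N] := boolP (infix [:: Rho; Mu] w).
  apply: (IH (u ++ [:: Mu; Rho] ++ v)).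
    apply: leq_trans wm; rewrite E !mu_delay_cat /= !(add0n, addn0, addn1, add1n); lia.
  move: R; rewrite E /completes !(run_cat _ u).
  by case: (run 2 u _) => //= s; apply: rho_mu_run.
have reduce a b : (a, b) = (Rho, Lam) \/ (a, b) = (Lam, Rho) -> bad_prefix a b w ->
    exists2 w', calL w' & completes 2 w' (start n) p.
  move=> ab [u [v [/prefixP [r E] L Du]]].
  have {}E : w = u ++ [:: a; b] ++ v ++ [:: Lam; Mu] ++ r by rewrite E -!catA.
  apply: (IH (u ++ [:: b; a] ++ v ++ [:: Mu; Lam] ++ r)).
    apply: leq_trans wm; rewrite E !mu_delay_cat.
    by case: ab => -[-> ->] /=; rewrite !(add0n, addn0, addn1, add1n); lia.
  move: R; rewrite E /completes !(run_cat _ u).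
  case Eu: (run 2 u _) => [[i s bs o]|] //.
  have [/= Ds _] := counter_runD (run_counter Eu).1.
  have {Ds} : size s = 1 by lia.
  case: s {Eu} => [|x [|? ?]] // _.
  by apply: (@Lk1_block_run [:: a; b] [:: b; a]) => //; case: ab => -[-> ->]; [left|right].
have [B1|N1] := pselect (bad_prefix Rho Lam w); first by apply: reduce B1; left.
have [B2|N2] := pselect (bad_prefix Lam Rho w); first by apply: reduce B2; right.
by exists w => //; split=> //; apply/LkP; have [] := run_counter R.
Qed.

(** * Lengths, one-line notation and the bijection *)

Lemma Lk_size k w : Lk k w -> size w = 3 * count_mem Rho w.
Proof.
case=> _; rewrite /D => -[H1 H2].
have -> : size w = count_mem Rho w + count_mem Lam w + count_mem Mu w.
  by elim: w {H1 H2} => //= -[] w -> /=; lia.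
lia.
Qed.

Lemma one_line_inj n : injective (@one_line n).
Proof.
move=> p q /eq_in_map H; apply/perm.permP => i.
by have [/val_inj] := H i (mem_enum _ i).
Qed.

Lemma one_line_surj n o : perm_eq (iota 1 n) o ->
  exists p : 'S_n, one_line p = o.
Proof.
move=> P; have so : size o = n by rewrite -(perm_size P) size_iota.
have bound (i : 'I_n) : 0 < nth 0 o i <= n.
  by have := mem_nth 0 (s := o) (n := i); rewrite -(perm_mem P) so ltn_ord mem_iota;
    exact.
(* Tokens are numbered from 1, ordinals from 0; hence the predecessor. *)
have lt (i : 'I_n) : (nth 0 o i).-1 < n by have := bound i; lia.
have inj : injective (fun i : 'I_n => Ordinal (lt i)).
  move=> i j /(congr1 val) /= E; apply/val_inj/eqP.
  rewrite -(nth_uniq 0 (s := o)) ?so // ?ltn_ord // -?(perm_uniq P) ?iota_uniq //.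
  have /andP[i_gt0 _] := bound i; have /andP[j_gt0 _] := bound j.
  by rewrite -(prednK i_gt0) E prednK.
exists (perm inj); rewrite /one_line.
rewrite (eq_map (g := nth 0 o \o val)); last first.
  by move=> i; rewrite permE /= prednK //; have /andP[] := bound i.
by rewrite map_comp val_enum_ord -[X in iota 0 X]so map_nth_iota0 // take_size.
Qed.

Lemma calL_generates n w : calL w -> size w = 3 * n ->
  exists p : 'S_n, generates 2 w p.
Proof.
move=> [L _ _ _] sw; have cw : count_mem Rho w = n by have := Lk_size L; lia.
have /LkP C := L.
have [|[i a b o] R] := @counter_run_run 2 w (start n) _ C.
  by rewrite /= size_iota cw.
have [/= E] := run_counter R; rewrite size_iota cw => si.
move: E; rewrite C => -[sa sb].
case: a sa R => // _; case: b sb => // _; case: i si => [_ R|]; last by move=> /= *; lia.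
have := run_perm R; rewrite /content /= cats0 => /one_line_surj [p E].
by exists p; rewrite /generates E.
Qed.

Theorem theorem3p8 (n : nat) :
  exists f : 'S_n -> seq move,
    set_bij (@calP n) [set w : seq move | calL w /\ size w = 3 * n]%classic f.
Proof.
have ex (p : 'S_n) : exists w, calP p -> calL w /\ generates 2 w p.
  (* Outside [calP] the value is arbitrary; the empty word fills in. *)
  have [[w G]|N] := pselect (calP p); last by exists [::].
  by have [w' L R] := generated_by_calL G; exists w'.
have [f fP] := choice ex.
exists f; split.
- move=> p /fP [L G]; split=> //.
  have [_ /= E] := run_counter G; case: L => L _ _ _.
  by move: E; rewrite (Lk_size L) size_iota addn0 => ->.
- move=> p q /set_mem /fP [_ Gp] /set_mem /fP [_ Gq] E.
  by apply: one_line_inj; move: Gp; rewrite /generates E Gq => -[].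
move=> w [L sw]; have [p G] := calL_generates L sw.
have Pp : calP p by exists w.
(* Both [f p] and [w] lie in [calL] and generate [p], so uniqueness from the empty prefix identifies
   them. *)
exists p => //; have [Lf Gf] := fP p Pp.
exact: (@calL_completes_inj n (f p) w [::] (start n)) Gf G.
Qed.
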